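(* Consider the dual initial boundary value problem $$P\Phi_\tau-(A_i(V)\Phi)_{x_i}-A_i(V)^T\Phi_{x_i}-C(V)\Phi=G,\qquad \vec x\in\Omega,\ \tau\ge 0,$$ $$L_d\Phi=q,\quad \vec x\in\partial\Omega,\ \tau\ge0,\qquad\qquad \Phi=r,\quad \vec x\in\Omega,\ \tau=0,$$ where $G$ is the forcing function, $q$ is boundary data and $r$ is initial data. For both the linear ($V\neq\Phi$) and the nonlinear ($V=\Phi$) version of this problem: (1) The problem is energy conserving if $C+C^T=0$ holds. (2) The problem is energy bounded if it is energy conserving and the boundary conditions $L_d\Phi=0$ are such that $$\oint_{\partial\Omega}\Phi^T(n_iA_i)\,\Phi\,ds=\oint_{\partial\Omega}\tfrac12\,\Phi^T\big((n_iA_i)+(n_iA_i)^T\big)\Phi\,ds\ \le\ 0.$$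
   Context: The Einstein summation convention is used for the repeated index $i=1,\dots,k$; subscripts $\tau$ and $x_i$ denote partial derivatives. The problem is the dual, written in the reversed time $\tau=T-t$ with $T$ the final time, of the primal problem $PU_t+(A_i(V)U)_{x_i}+A_i^T(V)U_{x_i}+C(V)U=F$ with solution $U$ and forcing function $F$. $\Omega$ is the spatial domain with points $\vec x=(x_1,\dots,x_k)$, $\partial\Omega$ its boundary, and $(n_1,\dots,n_k)^T$ the outward pointing unit normal. $\Phi$ is the dual solution and $V$ is an $n$ component long vector; the solution and $V$ are assumed smooth. The dual problem is called linear when $V\neq\Phi$ and nonlinear when $V=\Phi$. $P$ is a symmetric positive definite (or semi-definite) time-independent matrix that defines an energy norm (or semi-norm) by $\|\Phi\|_P^2=\int_\Omega\Phi^TP\Phi\,d\Omega$. The $n\times n$ matrices $A_i,C$ are smooth functions (each matrix element is smooth) of the vector $V$, but otherwise arbitrary. $L_d$ is the dual boundary operator; the homogeneous dual boundary conditions $L_d\Phi=0$ are such that $\Phi^T(n_iA_i)U=0$ on $\partial\Omega$ when the homogeneous primal boundary conditions are applied to $U$. Definitions. The problem is energy conserving if $\|\Phi\|_P^2=\int_\Omega\Phi^TP\Phi\,d\Omega$ only changes due to boundary effects. It is energy bounded if $\|\Phi\|_P^2<\infty$ as $\tau\to\infty$.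
   Formalization: With nonzero forcing G the claims fail literally (P=I, A_i=C=0, constant G gives energy growing like τ²); so in (1) energy may also change by the work of G, 2∫Φ^T G, and (2) is stated for G=0 and q=0. *)

(* Defs.v *)
From HB Require Import structures.
From mathcomp Require Import all_boot all_order all_algebra.
From mathcomp Require Import all_classical all_reals all_analysis.

Set Implicit Arguments.
Unset Strict Implicit.
Unset Printing Implicit Defensive.

Import Order.TTheory GRing.Theory Num.Theory.
Import numFieldNormedType.Exports.

Local Open Scope classical_set_scope.
Local Open Scope ring_scope.

(* "Smooth" is read as C^1, the regularity that the equation requires, on an
   open neighbourhood of [K], so that derivatives make sense on all of [K]. *)
Definition smooth_on (R : realType) (X Y : normedModType R) (K : set X)
    (f : X -> Y) : Prop :=
  exists2 U : set X, open U /\ K `<=` U &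
    forall x, U x -> differentiable f x /\
      forall v : X, {for x, continuous (fun y => 'D_v f y)}.

Definition boundary (T : topologicalType) (A : set T) : set T :=
  closure A `\` interior A.

Definition borel_space (R : realType) (k : nat) :=
  g_sigma_algebraType (@open 'rV[R]_k).

(* The condition on boxes determines a Borel measure on R^k uniquely. *)
Definition is_lebesgue (R : realType) (k : nat)
    (vol : {measure set (borel_space R k) -> \bar R}) : Prop :=
  forall a b : 'rV[R]_k, (forall i, a ord0 i <= b ord0 i) ->
    vol [set x : 'rV[R]_k | forall i, a ord0 i <= x ord0 i <= b ord0 i]
    = (\prod_i (b ord0 i - a ord0 i))%:E.

Definition partial_x (R : realType) (k : nat) (W : normedModType R)
    (i : 'I_k) (f : 'rV[R]_k -> W) (x : 'rV[R]_k) : W :=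
  'D_(delta_mx ord0 i) f x.

Definition divergence (R : realType) (k : nat)
    (F : 'rV[R]_k -> 'rV[R]_k) (x : 'rV[R]_k) : R :=
  \sum_(i < k) partial_x i (fun y => F y ord0 i : R) x.

Record domain (R : realType) (k : nat) := Domain {
  region :> set 'rV[R]_k;
  normal : 'rV[R]_k -> 'rV[R]_k;
  surface : {finite_measure set (borel_space R k) -> \bar R}
}.

(* A bounded open set with outward unit normal and surface measure, for which
   the divergence theorem holds.  Since the normal has unit length, the last
   identity says that [normal * surface] is minus the distributional gradient
   of the indicator function of the region, so it determines the surface
   measure, and the normal almost everywhere. *)
Record gauss_domain (R : realType) (k : nat)
    (vol : {measure set (borel_space R k) -> \bar R}) (Om : domain R k)
    : Prop := GaussDomain {
  region_open : open (Om : set 'rV[R]_k);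
  region_bounded : bounded_set (Om : set 'rV[R]_k);
  normal_measurable : forall i : 'I_k,
    measurable_fun [set: borel_space R k] (fun x => normal Om x ord0 i : R);
  normal_unit : forall x, boundary Om x ->
    \sum_(i < k) normal Om x ord0 i ^+ 2 = 1;
  normal_outward : {ae surface Om, forall x : borel_space R k,
    boundary Om x -> exists2 e : R, 0 < e & forall t : R, 0 < t < e ->
      (Om : set 'rV[R]_k) ((x : 'rV[R]_k) - t *: normal Om x) /\
      ~ closure (Om : set 'rV[R]_k) ((x : 'rV[R]_k) + t *: normal Om x)};
  surface_boundary : surface Om (~` boundary Om) = 0%E;
  divergence_theorem : forall F : 'rV[R]_k -> 'rV[R]_k,
    smooth_on (closure Om) F ->
    \int[vol]_(x in Om) divergence F x =
    \int[surface Om]_(x in boundary Om)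
      (\sum_(i < k) normal Om x ord0 i * F x ord0 i)
}.

(* Functions of the reversed time tau and of the position x. *)
Definition field (R : realType) (k n : nat) := R -> 'rV[R]_k -> 'cV[R]_n.

Definition smooth_field (R : realType) (k n : nat) (Om : domain R k)
    (f : field R k n) : Prop :=
  smooth_on [set tx : R * 'rV[R]_k | 0 <= tx.1 /\ closure Om tx.2]
    (fun tx => f tx.1 tx.2).

(* [Linear V]: the coefficients are evaluated at a given field [V], the same
   for all dual solutions.  [Nonlinear]: they are evaluated at the dual
   solution. *)
Inductive version (R : realType) (k n : nat) :=
  | Linear of field R k n
  | Nonlinear.

Definition coefficient_field (R : realType) (k n : nat) (ver : version R k n)
    (Phi : field R k n) : field R k n :=
  match ver with
  | Linear V => V
  | Nonlinear => Phi
  end.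

(* [bcLp] and [bcLd] are the primal and the dual boundary operators; they may be
   nonlinear, may involve derivatives, and may depend on time and position. *)
Record dual_problem (R : realType) (k n mp md : nat) := DualProblem {
  matP : 'rV[R]_k -> 'M[R]_n;
  matA : 'I_k -> 'cV[R]_n -> 'M[R]_n;
  matC : 'cV[R]_n -> 'M[R]_n;
  bcLp : field R k n -> field R k mp;
  bcLd : field R k n -> field R k md;
  ver : version R k n
}.

Section DualProblem.
Context (R : realType) (k n mp md : nat).
Context (vol : {measure set (borel_space R k) -> \bar R}) (Om : domain R k).
Context (pb : dual_problem R k n mp md).
Implicit Types (Phi U G : field R k n) (q : field R k md).
Implicit Types (r : 'rV[R]_k -> 'cV[R]_n) (tau : R) (x : 'rV[R]_k).

(* n_i A_i(V) *)
Definition normal_matrix Phi tau x : 'M[R]_n :=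
  \sum_(i < k)
    normal Om x ord0 i *: matA pb i (coefficient_field (ver pb) Phi tau x).

Definition boundary_condition (m : nat) (L : field R k n -> field R k m)
    Phi (q : field R k m) : Prop :=
  forall tau x, 0 <= tau -> boundary Om x -> L Phi tau x = q tau x.

Record admissible : Prop := Admissible {
  P_continuous : {within closure Om, continuous (matP pb)};
  P_symmetric : forall x, closure Om x -> (matP pb x)^T = matP pb x;
  P_semidefinite : forall x (w : 'cV[R]_n), closure Om x ->
    0 <= (w^T *m matP pb x *m w) ord0 ord0;
  A_smooth : forall i, smooth_on setT (matA pb i);
  C_smooth : smooth_on setT (matC pb);
  V_smooth : forall V, ver pb = Linear V -> smooth_field Om V;
  dual_boundary_conditions : forall Phi U,
    smooth_field Om Phi -> smooth_field Om U ->
    boundary_condition (bcLp pb) U (fun _ _ => 0) ->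
    boundary_condition (bcLd pb) Phi (fun _ _ => 0) ->
    forall tau x, 0 <= tau -> boundary Om x ->
      (Phi tau x)^T *m normal_matrix Phi tau x *m U tau x = 0
}.

Definition dual_equation G Phi : Prop :=
  forall tau x, 0 <= tau -> (Om : set _) x ->
  let V := coefficient_field (ver pb) Phi in
  matP pb x *m 'D_1 (fun s : R => Phi s x) tau
  - \sum_(i < k) partial_x i (fun y => matA pb i (V tau y) *m Phi tau y) x
  - \sum_(i < k) (matA pb i (V tau x))^T *m partial_x i (Phi tau) x
  - matC pb (V tau x) *m Phi tau x
  = G tau x.

Record solution G q r Phi : Prop := Solution {
  solution_smooth : smooth_field Om Phi;
  solution_equation : dual_equation G Phi;
  solution_boundary : boundary_condition (bcLd pb) Phi q;
  solution_initial : forall x, (Om : set _) x -> Phi 0 x = r x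
}.

(* The squared (semi-)norm of [Phi] at time [tau]. *)
Definition energy Phi tau : R :=
  \int[vol]_(x in Om)
    ((Phi tau x)^T *m matP pb x *m Phi tau x) ord0 ord0.

Definition boundary_flux Phi tau : R :=
  \int[surface Om]_(x in boundary Om)
    ((Phi tau x)^T *m normal_matrix Phi tau x *m Phi tau x) ord0 ord0.

Definition symmetric_boundary_flux Phi tau : R :=
  \int[surface Om]_(x in boundary Om)
    (2^-1 * ((Phi tau x)^T
             *m (normal_matrix Phi tau x + (normal_matrix Phi tau x)^T)
             *m Phi tau x) ord0 ord0).

Definition forcing_power G Phi tau : R :=
  \int[vol]_(x in Om) ((Phi tau x)^T *m G tau x) ord0 ord0.

(* Apart from the work done by the external forcing, which is zero if [G = 0],
   the energy changes only by the flux through the boundary; the factors 2 are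
   due to the energy being the norm squared, without a factor 1/2. *)
Definition energy_conserving G q r : Prop :=
  forall Phi, solution G q r Phi -> forall tau, 0 <= tau ->
    is_derive tau 1 (energy Phi)
      (2 * boundary_flux Phi tau + 2 * forcing_power G Phi tau).

(* Each norm is finite, so the content is that the norm does not blow up as
   time tends to infinity. *)
Definition energy_bounded G q r : Prop :=
  forall Phi, solution G q r Phi ->
    exists M : R, forall tau, 0 <= tau -> energy Phi tau <= M.

Definition dissipative_boundary_conditions : Prop :=
  forall Phi, smooth_field Om Phi ->
    boundary_condition (bcLd pb) Phi (fun _ _ => 0) ->
    forall tau, 0 <= tau -> symmetric_boundary_flux Phi tau <= 0.

End DualProblem.

(* Main.v *)
Require Import Defs.
From mathcomp Require Import all_boot all_order all_algebra.
From mathcomp Require Import lra.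
From mathcomp Require Import all_classical all_reals all_analysis.
Import Order.TTheory GRing.Theory Num.Theory.
Import numFieldNormedType.Exports.
Local Open Scope classical_set_scope.
Local Open Scope ring_scope.

(** The energy method.  Multiplying the dual equation by [Phi^T] turns the two
first-order terms into an exact divergence: by the product rule,
[Phi^T (A_i Phi)_{x_i} + Phi^T A_i^T Phi_{x_i}] is the divergence of the flux
[F_i = Phi^T A_i Phi].  This uses nothing about where [A_i] is evaluated, except
that [x |-> A_i(V(tau, x))] is C^1, so the linear and the nonlinear version are
treated together.  The zeroth-order term [Phi^T C Phi] vanishes because [C] is
skew-symmetric.  Hence, pointwise, [Phi^T P Phi_tau = div F + Phi^T G]
([power_balance]).

As [P] is symmetric and independent of time, [2 Phi^T P Phi_tau] is the time
derivative of the energy density.  Integrating over the domain, and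
differentiating under the integral sign ([energy_is_derive]), the rate of change
of the energy is twice the integral of [div F] plus twice the work of the
forcing; the divergence theorem turns the former into the boundary flux
([boundary_flux_divergence]).  The differentiation under the integral needs a
bound on [Phi^T P Phi_tau] for times in a neighbourhood of [tau], in particular
for some negative times if [tau = 0].  The solution is C^1 on a neighbourhood of
the closed half-cylinder only, and it is the compactness of the closed domain
that makes this neighbourhood contain a slab of positive thickness around
[tau] ([tube_lemma]).

For the second part, a quadratic form only sees the symmetric part of its
matrix, so that the two expressions of the boundary flux agree.  With
dissipative boundary conditions, no forcing and no boundary data, the energy has
a nonpositive derivative, and its initial value bounds it for all times. *)

Set Implicit Arguments.
Unset Strict Implicit.
Unset Printing Implicit Defensive.

(** * Limits of matrix-valued functions *)

Section MatrixLimits.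
Context (R : realType) (T : Type) (F : set_system T).
Context {FF : Filter F}.

Lemma cvg_mxP m n (f : T -> 'M[R]_(m, n)) (M : 'M[R]_(m, n)) :
  f @ F --> M <-> forall i j, f x i j @[x --> F] --> M i j.
Proof.
split=> [fM i j|fM].
  exact: (cvg_comp _ _ fM (@coord_continuous _ _ _ i j M)).
apply/cvgrPdist_lt => e e0; near=> x.
rewrite [ltLHS]/Num.Def.normr/= mx_normrE; apply/bigmax_ltP; split=> //= ij _.
rewrite !mxE; move: ij; near: x; apply: filter_forall => ij /=.
by move/cvgrPdist_lt: (fM ij.1 ij.2); apply.
Unshelve. all: by end_near. Qed.

Lemma cvg_sum (I : finType) (f : I -> T -> R) (a : I -> R) :
  (forall i, f i x @[x --> F] --> a i) ->
  \sum_i f i x @[x --> F] --> \sum_i a i.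
Proof. by move=> fa; apply: cvg_big => // -[x y]; exact: add_continuous. Qed.

Lemma cvg_mulmx m n p (f : T -> 'M[R]_(m, n)) (g : T -> 'M[R]_(n, p))
    (A : 'M[R]_(m, n)) (B : 'M[R]_(n, p)) :
  f @ F --> A -> g @ F --> B -> f x *m g x @[x --> F] --> A *m B.
Proof.
move=> /cvg_mxP fA /cvg_mxP gB; apply/cvg_mxP => i j; rewrite mxE.
under eq_fun do rewrite mxE.
by apply: cvg_sum => l; exact: cvgM.
Qed.

Lemma cvg_trmx m n (f : T -> 'M[R]_(m, n)) (A : 'M[R]_(m, n)) :
  f @ F --> A -> (f x)^T @[x --> F] --> A^T.
Proof.
move=> /cvg_mxP fA; apply/cvg_mxP => i j; rewrite mxE.
by under eq_fun do rewrite mxE; exact: fA.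
Qed.

Lemma cvg_bilinear n (a b : T -> 'cV[R]_n) (Q : T -> 'M[R]_n)
    (a0 b0 : 'cV[R]_n) (Q0 : 'M[R]_n) :
  a @ F --> a0 -> Q @ F --> Q0 -> b @ F --> b0 ->
  ((a x)^T *m Q x *m b x) ord0 ord0 @[x --> F]
    --> (a0^T *m Q0 *m b0) ord0 ord0.
Proof.
move=> ca cQ cb.
have : (a x)^T *m Q x *m b x @[x --> F] --> a0^T *m Q0 *m b0.
  by apply: cvg_mulmx cb; apply: cvg_mulmx cQ; exact: cvg_trmx.
by move/cvg_mxP; exact.
Qed.

End MatrixLimits.

(** * Continuously differentiable functions *)

Section C1.
Context (R : realType).

(** The pointwise part of [smooth_on], with the open set made explicit: the
calculus rules below then keep the same open set, and only the few functions
that come with different open sets need an intersection. *)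
Definition C1_on (X Y : normedModType R) (U : set X) (f : X -> Y) :=
  forall x, U x ->
    differentiable f x /\ forall v, {for x, continuous (fun y => 'D_v f y)}.

Lemma derive_coord (X : normedModType R) m n (f : X -> 'M[R]_(m, n)) x v i j :
  differentiable f x -> 'D_v (fun y => f y i j) x = ('D_v f x) i j.
Proof. by move=> /diff_derivable df; rewrite derive_mx// mxE. Qed.

Lemma differentiable_mx (X : normedModType R) m n (f : X -> 'M[R]_(m, n)) x :
  (forall i j, differentiable (fun y => f y i j) x) -> differentiable f x.
Proof.
move=> df.
rewrite (_ : f = \sum_i \sum_j (fun y => f y i j *: delta_mx i j)).
  by do 2!(apply: differentiable_sum => ?); exact: differentiableZl.
apply/funext => y; rewrite fct_sumE {1}(matrix_sum_delta (f y)).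
by apply: eq_bigr => i _; rewrite fct_sumE.
Qed.

Section Calculus.
Context (X : normedModType R) (U : set X).
Hypothesis openU : open U.

(** The differentiation rules hold at points of differentiability only, hence on
[U]; as [U] is open, this is enough to transfer continuity. *)
Lemma open_eq_continuous (Y : topologicalType) (f g : X -> Y) x : U x ->
  (forall y, U y -> f y = g y) -> {for x, continuous g} ->
  {for x, continuous f}.
Proof.
move=> Ux fg; rewrite /prop_for /continuous_at fg//.
apply: cvg_trans; apply: near_eq_cvg.
by apply: filterS (open_nbhs_nbhs (conj openU Ux)) => y Uy; rewrite fg.
Qed.

Lemma C1_onD (f g : X -> R) : C1_on U f -> C1_on U g ->
  C1_on U (fun x => f x + g x).
Proof.
move=> Cf Cg x Ux; have [df cf] := Cf x Ux; have [dg cg] := Cg x Ux.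
split=> [|v]; first exact: differentiableD.
apply: (@open_eq_continuous _ _ (fun y => 'D_v f y + 'D_v g y)) => // [y Uy|].
  by rewrite deriveD//; apply: diff_derivable; [case: (Cf y Uy)|case: (Cg y Uy)].
by apply: cvgD; [exact: cf|exact: cg].
Qed.

Lemma C1_onM (f g : X -> R) : C1_on U f -> C1_on U g ->
  C1_on U (fun x => f x * g x).
Proof.
move=> Cf Cg x Ux; have [df cf] := Cf x Ux; have [dg cg] := Cg x Ux.
split=> [|v]; first exact: differentiableM.
apply: (@open_eq_continuous _ _
    (fun y => f y * 'D_v g y + g y * 'D_v f y)) => // [y Uy|].
  by rewrite deriveM//; apply: diff_derivable; [case: (Cf y Uy)|case: (Cg y Uy)].
apply: cvgD; apply: cvgM; [|exact: cg| |exact: cf];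
  exact: differentiable_continuous.
Qed.

Lemma C1_on_cst (Y : normedModType R) (a : Y) : C1_on U (fun=> a).
Proof.
move=> x _; split=> [|v]; first exact: differentiable_cst.
have -> : (fun y => 'D_v (fun=> a) y) = cst 0 :> (X -> Y).
  by apply/funext => y; exact: derive_cst.
exact: cvg_cst.
Qed.

Lemma C1_on_sum (I : finType) (f : I -> X -> R) :
  (forall i, C1_on U (f i)) -> C1_on U (fun x => \sum_i f i x).
Proof.
move=> Cf; rewrite (_ : (fun x => _) = \sum_i f i); last first.
  by apply/funext => x; rewrite fct_sumE.
apply: (big_ind (C1_on U)) => [|g h Cg Ch|i _]; last exact: Cf.
  exact: (C1_on_cst (0 : R)).
exact: C1_onD Cg Ch.
Qed.

Lemma C1_on_coord m n (f : X -> 'M[R]_(m, n)) i j :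
  C1_on U f -> C1_on U (fun x => f x i j).
Proof.
move=> Cf x Ux; have [df cf] := Cf x Ux; split=> [|v].
  exact: (differentiable_comp df (@differentiable_coord _ _ _ _ i j)).
apply: (@open_eq_continuous _ _ (fun y => ('D_v f y) i j)) => // [y Uy|].
  by rewrite derive_coord//; case: (Cf y Uy).
exact: (cvg_comp _ _ (cf v) (@coord_continuous _ _ _ i j _)).
Qed.

Lemma C1_on_mx m n (f : X -> 'M[R]_(m, n)) :
  (forall i j, C1_on U (fun x => f x i j)) -> C1_on U f.
Proof.
move=> Cf; have df x : U x -> differentiable f x.
  by move=> Ux; apply: differentiable_mx => i j; case: (Cf i j x Ux).
move=> x Ux; split=> [|v]; first exact: df.
apply/cvg_mxP => i j.
have c : {for x, continuous (fun y => ('D_v f y) i j)}.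
  apply: (@open_eq_continuous _ _ (fun y => 'D_v (fun z => f z i j) y)) => //.
    by move=> y Uy; rewrite derive_coord//; exact: df.
  by have [_] := Cf i j x Ux; exact.
exact: c.
Qed.

Lemma C1_on_mulmx m n p (f : X -> 'M[R]_(m, n)) (g : X -> 'M[R]_(n, p)) :
  C1_on U f -> C1_on U g -> C1_on U (fun x => f x *m g x).
Proof.
move=> Cf Cg; apply: C1_on_mx => i j.
under eq_fun do rewrite mxE.
by apply: C1_on_sum => l; apply: C1_onM; exact: C1_on_coord.
Qed.

Lemma C1_on_trmx m n (f : X -> 'M[R]_(m, n)) :
  C1_on U f -> C1_on U (fun x => (f x)^T).
Proof.
move=> Cf; apply: C1_on_mx => i j.
by under eq_fun do rewrite mxE; exact: C1_on_coord.
Qed.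

(** The intermediate space is finite dimensional because continuity of each
directional derivative is assumed for fixed directions only: the direction
[D_v f] varies with the point, and is expanded in the canonical basis. *)
Lemma C1_on_comp n (Y : normedModType R) (f : X -> 'cV[R]_n)
    (g : 'cV[R]_n -> Y) :
  C1_on setT g -> C1_on U f -> C1_on U (g \o f).
Proof.
move=> Cg Cf x Ux; have [df cf] := Cf x Ux; have [dg cg] := Cg (f x) I.
split=> [|v]; first exact: differentiable_comp.
pose h y := \sum_(i < n) 'D_v f y i ord0 *: 'D_(delta_mx i ord0) g (f y).
apply: (@open_eq_continuous _ _ h) => // [y Uy|].
  have [dfy _] := Cf y Uy; have [dgy _] := Cg (f y) I.
  rewrite deriveE; last exact: differentiable_comp.
  rewrite diff_comp//= -(deriveE v dfy) {1}(matrix_sum_delta ('D_v f y)).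
  rewrite linear_sum; apply: eq_bigr => i _.
  by rewrite big_ord1 linearZ/= -deriveE.
apply: (@cvg_big _ _ _ _ xpredT) => //.
  by move=> -[a b]; exact: add_continuous.
move=> i _; apply: cvgZ.
  exact: (cvg_comp _ _ (cf v) (@coord_continuous _ _ _ i ord0 _)).
have cfx : f @ x --> f x by exact: differentiable_continuous.
exact: (cvg_comp _ _ cfx (cg (delta_mx i ord0))).
Qed.

End Calculus.

Lemma is_derive_dot (X : normedModType R) n (u w : X -> 'cV[R]_n) x v :
  derivable u x v -> derivable w x v ->
  is_derive x v (fun y => ((u y)^T *m w y) ord0 ord0)
    (((u x)^T *m 'D_v w x + (w x)^T *m 'D_v u x) ord0 ord0).
Proof.
move=> du dw; have /derivable_mxP duij := du; have /derivable_mxP dwij := dw.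
rewrite (_ : (fun y => _) = \sum_(i < n)
    ((fun y => u y i ord0) * (fun y => w y i ord0))); last first.
  apply/funext => y; rewrite fct_sumE mxE; apply: eq_bigr => i _.
  by rewrite mxE.
apply: DeriveDef; first by apply: derivable_sum => i; exact: derivableM.
rewrite derive_sum; last by move=> i; exact: derivableM.
rewrite (derive_mx du) (derive_mx dw) !mxE -big_split/=.
by apply: eq_bigr => i _; rewrite deriveM// !mxE.
Qed.

Lemma is_derive_mulmxl (X : normedModType R) m n (A : 'M[R]_(m, n))
    (u : X -> 'cV[R]_n) x v :
  derivable u x v -> is_derive x v (fun y => A *m u y) (A *m 'D_v u x).
Proof.
move=> du; have /derivable_mxP duij := du.
have AE i j : (fun y => (A *m u y) i j) =
    \sum_l A i l *: (fun y => u y l j).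
  by apply/funext => y; rewrite fct_sumE mxE.
have dA : derivable (fun y => A *m u y) x v.
  apply/derivable_mxP => i j; rewrite AE.
  by apply: derivable_sum => l; exact: derivableZ.
apply: DeriveDef => //; rewrite derive_mx//; apply/matrixP => i j.
rewrite !mxE AE derive_sum; last by move=> l; exact: derivableZ.
by apply: eq_bigr => l _; rewrite deriveZ// derive_mx// mxE.
Qed.

End C1.

(** * Functions of time and space *)

Section Slices.
Context (R : realType).

(** Both the time derivative at a fixed position and the space derivatives at a
fixed time are directional derivatives in space-time: along an affine map the
difference quotients are literally the same. *)
Lemma derive_affine (Z X Y : normedModType R) (f : X -> Y) (a : Z -> X) z v w :
  (forall h : R, a (h *: v + z) = h *: w + a z) ->
  'D_v (fun y => f (a y)) z = 'D_w f (a z).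
Proof.
move=> aE; rewrite /derive; set p := fun h => _; set q := fun h => _.
by suff -> : p = q by []; apply/funext => h; rewrite /p /q /= aE.
Qed.

Lemma derivable_affine (Z X Y : normedModType R) (f : X -> Y) (a : Z -> X)
    z v w :
  (forall h : R, a (h *: v + z) = h *: w + a z) ->
  derivable f (a z) w -> derivable (fun y => f (a y)) z v.
Proof.
move=> aE; rewrite /derivable => df.
set p := fun h => _; set q := (fun h => _) in df.
by suff -> : p = q by []; apply/funext => h; rewrite /p /q /= aE.
Qed.

Context (X Y : normedModType R) (f : R * X -> Y).

Lemma time_affine (t h : R) (x : X) :
  (h%:A + t, x) = h *: (1, 0) + (t, x) :> R * X.
Proof. by congr pair => /=; rewrite scaler0 add0r. Qed.

Lemma space_affine (t h : R) (v x : X) :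
  (t, h *: v + x) = h *: (0, v) + (t, x) :> R * X.
Proof. by congr pair => /=; rewrite scaler0 add0r. Qed.

Lemma derive_time t x : 'D_1 (fun s => f (s, x)) t = 'D_(1, 0) f (t, x).
Proof.
by apply: (@derive_affine _ _ _ f (fun s => (s, x))) => h; exact: time_affine.
Qed.

Lemma derivable_time t x :
  differentiable f (t, x) -> derivable (fun s => f (s, x)) t 1.
Proof.
move=> df; apply: (@derivable_affine _ _ _ f (fun s => (s, x)) _ _ (1, 0)).
  by move=> h; exact: time_affine.
exact: diff_derivable.
Qed.

Lemma derive_space t x v : 'D_v (fun y => f (t, y)) x = 'D_(0, v) f (t, x).
Proof.
by apply: (@derive_affine _ _ _ f (pair t)) => h; exact: space_affine.
Qed.

Lemma pair_continuous (t : R) : continuous (pair t : X -> R * X).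
Proof.
move=> x; have h := cvg_pair (cvg_cst t) (@cvg_id _ (nbhs x)).
by apply: h.
Qed.

Lemma open_slice (U : set (R * X)) t : open U -> open [set x | U (t, x)].
Proof.
move=> oU; rewrite (_ : [set x | _] = pair t @^-1` U)//.
by apply: open_comp => // x _; exact: pair_continuous.
Qed.

Lemma C1_on_slice (U : set (R * X)) t : C1_on U f ->
  C1_on [set x | U (t, x)] (fun x => f (t, x)).
Proof.
move=> Cf x /= Utx; have [df cf] := Cf (t, x) Utx; split=> [|v].
  apply: (@differentiable_comp _ _ _ _ (pair t) f) => //.
  by apply: differentiable_pair.
have -> : (fun y => 'D_v (fun x => f (t, x)) y) =
    (fun y => 'D_(0, v) f (t, y)).
  by apply/funext => y; exact: derive_space.
exact: (cvg_comp _ _ (@pair_continuous t x) (cf (0, v))).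
Qed.

End Slices.

Lemma tube_lemma (R : realType) (X : topologicalType) (K : set X)
    (U : set (R * X)) (t : R) :
  compact K -> open U -> (forall x, K x -> U (t, x)) ->
  \forall s \near t, forall x, K x -> U (s, x).
Proof.
move=> /compact_near_coveringP cK oU KU.
apply: (cK _ (nbhs t) (fun s x => U (s, x))) => x Kx.
have : nbhs (t, x) U by exact: open_nbhs_nbhs (conj oU (KU x Kx)).
move=> [[A B] [/= At Bx] AB]; exists (B, A) => // -[y s] [/= By As].
exact: (AB (s, y)).
Qed.

(** * Integrability on bounded open sets *)

Lemma compact_bounded_image (R : realType) (T : topologicalType) (K : set T)
    (f : T -> R) :
  compact K -> {within K, continuous f} ->
  exists2 M : R, 0 <= M & forall x, K x -> `|f x| <= M.
Proof.
move=> cK cf; have /compact_bounded[M [_ hM]] := continuous_compact cf cK.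
exists (`|M| + 1) => [|x Kx]; first by rewrite addr_ge0.
by apply: (hM (`|M| + 1)); [rewrite (le_lt_trans (ler_norm M)) ?ltrDl|exists x].
Qed.

Section Integrability.
Context (R : realType) (k : nat).
Context (vol : {measure set (borel_space R k) -> \bar R}).

Lemma open_borel (A : set 'rV[R]_k) :
  open A -> measurable (A : set (borel_space R k)).
Proof. by move=> oA; exact: sub_sigma_algebra. Qed.

Lemma measurable_fun_open_continuous (A : set 'rV[R]_k) (f : 'rV[R]_k -> R) :
  open A -> {in A, continuous f} ->
  measurable_fun (A : set (borel_space R k)) f.
Proof.
move=> oA cf; apply: (measurability (@measurable_realfun.RGenOpens.G R)).
  exact: measurable_realfun.RGenOpens.measurableE.
move=> _ [_ [a [b ->] <-]]; apply: open_borel.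
by move/continuous_inP : cf; apply => //; exact: interval_open.
Qed.

(** The same cube serves twice: as a compact set, it makes closures of bounded
sets compact; as a box of known volume, it makes bounded sets of finite
volume. *)
Definition cube (N : R) : set 'rV[R]_k :=
  [set x | forall i, - N <= x ord0 i <= N].

Lemma bounded_sub_cube (A : set 'rV[R]_k) :
  bounded_set A -> exists2 N, 0 <= N & A `<=` cube N.
Proof.
move=> [M [_ hM]]; exists (`|M| + 1) => [|x Ax i]; first by rewrite addr_ge0.
have xN : `|x| <= `|M| + 1.
  by apply: hM => //; rewrite (le_lt_trans (ler_norm M)) ?ltrDl.
rewrite -ler_norml; apply: le_trans xN.
rewrite [leRHS]/Num.Def.normr/= mx_normrE.
exact: (le_bigmax _ (fun ij => `|x ij.1 ij.2|) (ord0, i)).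
Qed.

Lemma closed_cube N : closed (cube N).
Proof.
rewrite (_ : cube N = \bigcap_i ((fun x => x ord0 i) @^-1` `[- N, N])).
  apply: closed_bigI => i _; apply: preimage_closed; last exact: interval_closed.
  by move=> x _; exact: coord_continuous.
apply/seteqP; split=> [x hx i _|x hx i]; rewrite /=.
  by have := hx i; rewrite in_itv.
by have := hx i I; rewrite /= in_itv.
Qed.

Lemma compact_closure (A : set 'rV[R]_k) : bounded_set A -> compact (closure A).
Proof.
move=> /bounded_sub_cube[N _ AN].
apply: (@subclosed_compact _ _ (cube N)); first exact: closed_closure.
  rewrite (_ : cube N = [set x | forall i, x ord0 i \in `[- N, N]]).
    apply: (rV_compact (A := fun=> `[- N, N]%classic)) => i.
    exact: segment_compact.
  by apply/seteqP; split=> x hx i; have := hx i; rewrite /= in_itv.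
exact: subset_trans (closure_subset AN) (@closed_cube N).
Qed.

Lemma bounded_finite_volume (A : set 'rV[R]_k) :
  is_lebesgue vol -> open A -> bounded_set A -> (vol A < +oo)%E.
Proof.
move=> leb oA /bounded_sub_cube[N N0 AN].
apply: (@le_lt_trans _ _ (vol (cube N))).
  apply: le_measure; rewrite ?inE//; first exact: open_borel.
  rewrite -[cube N]setCK; apply: measurableC; apply: open_borel.
  by apply: closed_openC; exact: closed_cube.
have -> : cube N = [set x : 'rV[R]_k | forall i,
    (const_mx (- N) : 'rV[R]_k) ord0 i <= x ord0 i <=
    (const_mx N : 'rV[R]_k) ord0 i].
  by apply/seteqP; split=> x hx i; have := hx i; rewrite !mxE.
by rewrite leb ?ltry// => i; rewrite !mxE; lra.
Qed.

Lemma continuous_integrable (A : set 'rV[R]_k) (f : 'rV[R]_k -> R) :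
  is_lebesgue vol -> open A -> bounded_set A ->
  {within closure A, continuous f} -> vol.-integrable A (EFin \o f).
Proof.
move=> leb oA bA cf; apply: measurable_bounded_integrable.
- exact: open_borel.
- exact: bounded_finite_volume.
- apply: measurable_fun_open_continuous => // x; rewrite inE => Ax.
  have : {within A, continuous f}.
    exact: continuous_subspaceW (@subset_closure _ A) cf.
  by rewrite continuous_open_subspace// => /(_ x); apply; rewrite inE.
- have [M _ hM] := compact_bounded_image (compact_closure bA) cf.
  exists M; split=> [|N MN x Ax]; first exact: num_real.
  by apply: le_trans (ltW MN); apply: hM; exact: subset_closure.
Qed.

End Integrability.

(** * Quadratic forms *)

Section QuadraticForms.
Context (R : realType) (n : nat).
Implicit Types (w : 'cV[R]_n) (Q : 'M[R]_n).

Lemma quadratic_trmx w Q :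
  (w^T *m Q^T *m w) ord0 ord0 = (w^T *m Q *m w) ord0 ord0.
Proof.
by rewrite -[in LHS](trmxK w) -!trmx_mul trmxK [in LHS]mxE mulmxA.
Qed.

Lemma quadratic_symmetrize w Q :
  2^-1 * (w^T *m (Q + Q^T) *m w) ord0 ord0 = (w^T *m Q *m w) ord0 ord0.
Proof. by rewrite mulmxDr mulmxDl mxE quadratic_trmx; lra. Qed.

Lemma quadratic_skew w Q : Q + Q^T = 0 -> (w^T *m Q *m w) ord0 ord0 = 0.
Proof.
by move=> Q0; rewrite -quadratic_symmetrize Q0 mulmx0 mul0mx mxE mulr0.
Qed.

End QuadraticForms.

(** * Differentiation of the energy under the integral sign *)

Section EnergyRate.
Context (R : realType) (k n : nat).
Context (Om : set 'rV[R]_k) (P : 'rV[R]_k -> 'M[R]_n).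
Hypothesis openOm : open Om.
Hypothesis boundedOm : bounded_set Om.
Hypothesis contP : {within closure Om, continuous P}.
Hypothesis symP : forall x, closure Om x -> (P x)^T = P x.
Context (u : field R k n) (U : set (R * 'rV[R]_k)).
Hypothesis openU : open U.
Hypothesis C1u : C1_on U (fun tx => u tx.1 tx.2).

(** The time derivative is taken as a directional derivative in space-time, so
that its joint continuity is part of the C^1 hypothesis. *)
Let u_t (tx : R * 'rV[R]_k) := 'D_(1, 0) (fun tx => u tx.1 tx.2) tx.
Let energy_density t x := ((u t x)^T *m P x *m u t x) ord0 ord0.
Let power t x := ((u t x)^T *m P x *m u_t (t, x)) ord0 ord0.

(** The factor 2 comes from the symmetry of [P]. *)
Lemma energy_density_is_derive t x : closure Om x -> U (t, x) ->
  is_derive t 1 (energy_density ^~ x) (2 * power t x).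
Proof.
move=> Kx Utx.
have du : derivable (fun s => u s x) t 1.
  by apply: (derivable_time (f := fun tx => u tx.1 tx.2)); case: (C1u Utx).
have [dPu PuE] := is_derive_mulmxl (P x) du.
rewrite (_ : energy_density ^~ x =
    (fun s => ((u s x)^T *m (P x *m u s x)) ord0 ord0)); last first.
  by apply/funext => s; rewrite /energy_density mulmxA.
apply: is_derive_eq; first exact: is_derive_dot du dPu.
rewrite PuE (derive_time (fun tx => u tx.1 tx.2)) trmx_mul symP// mxE mulmxA.
by rewrite /power mulr_natl mulr2n.
Qed.

Lemma snd_within (A : set R) (q : R * 'rV[R]_k) :
  snd @ within (A `*` closure Om) (nbhs q) --> within (closure Om) (nbhs q.2).
Proof.
move=> B; rewrite /within /= => hB.
have : nbhs q (snd @^-1` [set x | closure Om x -> B x]) by exact: cvg_snd.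
by apply: filterS => y h [_ Ky]; exact: h.
Qed.

Lemma power_continuous (A : set R) :
  A `*` closure Om `<=` U ->
  {within A `*` closure Om, continuous (fun q => power q.1 q.2)}.
Proof.
move=> KU; apply/subspace_continuousP => q Kq.
have [du cu] := C1u (KU q Kq).
apply: cvg_bilinear.
- by apply: cvg_within_filter; exact: (differentiable_continuous du).
- move/subspace_continuousP : contP => /(_ q.2 Kq.2) cP.
  exact: cvg_comp (@snd_within A q) cP.
- case: q Kq du cu => t x Kq du cu; apply: cvg_within_filter => /=.
  by have := cu (1, 0).
Qed.

Lemma slice_continuous t (v : R * 'rV[R]_k -> 'cV[R]_n) :
  (forall x, closure Om x -> U (t, x)) ->
  (forall x, closure Om x -> {for (t, x), continuous v}) ->
  {within closure Om, continuous (fun x =>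
    ((u t x)^T *m P x *m v (t, x)) ord0 ord0)}.
Proof.
move=> KU cv; apply/subspace_continuousP => x Kx.
have [du cu] := C1u (KU x Kx).
apply: cvg_bilinear.
- apply: cvg_within_filter.
  have cu0 := differentiable_continuous du.
  exact: (cvg_comp _ _ (@pair_continuous _ _ t x) cu0).
- by move/subspace_continuousP : contP; exact.
- apply: cvg_within_filter.
  exact: (cvg_comp _ _ (@pair_continuous _ _ t x) (cv x Kx)).
Qed.

Context (vol : {measure set (borel_space R k) -> \bar R}).
Hypothesis leb : is_lebesgue vol.

Lemma power_integrable t : (forall x, closure Om x -> U (t, x)) ->
  vol.-integrable Om (EFin \o power t).
Proof.
move=> KU.
apply: continuous_integrable => //; apply: slice_continuous => // x Kx.
by have [_ cu] := C1u (KU x Kx); exact: cu.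
Qed.

(** The dominating function is a constant: [power] is continuous, hence bounded,
on the product of a compact time interval around [t] and the closed domain. *)
Lemma energy_is_derive t : (forall x, closure Om x -> U (t, x)) ->
  is_derive t 1 (fun s => \int[vol]_(x in Om) energy_density s x)
    (2 * \int[vol]_(x in Om) power t x).
Proof.
move=> KU; have cK := compact_closure boundedOm.
have [d /= d0 dU] := tube_lemma cK openU KU.
(* Half the radius, so that the closed interval stays in the open ball. *)
pose A := `[t - d / 2, t + d / 2]%classic.
have AU : A `*` closure Om `<=` U.
  move=> [s x] []; rewrite /A/= in_itv/= => /andP[s1 s2] Kx.
  by apply: dU => //=; rewrite /ball_/= ltr_norml; lra.
have IA s : `]t - d / 2, t + d / 2[%classic s -> A s.
  by rewrite /A /= !in_itv/= => /andP[s1 s2]; lra.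
have It : `]t - d / 2, t + d / 2[%classic t by rewrite /= in_itv/=; lra.
have [M M0 pM] := compact_bounded_image
  (compact_setX (@segment_compact _ _ _) cK) (power_continuous AU).
have mOm := open_borel openOm.
have inte s : `]t - d / 2, t + d / 2[%classic s ->
    vol.-integrable Om (EFin \o energy_density s).
  move=> /IA As; apply: continuous_integrable => //.
  apply: (@slice_continuous _ (fun tx => u tx.1 tx.2)) => x Kx.
    exact: (AU (s, x)).
  by apply: differentiable_continuous; case: (C1u (AU (s, x) (conj As Kx))).
have dere s (x : borel_space R k) : `]t - d / 2, t + d / 2[%classic s ->
    Om x -> is_derive s 1 (energy_density ^~ x) (2 * power s x).
  move=> /IA As /subset_closure Kx.
  by apply: energy_density_is_derive => //; exact: (AU (s, x)).
have intG : vol.-integrable Om (EFin \o cst (2 * M)).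
  by apply: continuous_integrable => // x; exact: cvg_cst.
have G0 (y : borel_space R k) : 0 <= cst (2 * M) y.
  by rewrite /= mulr_ge0.
have Gub s (y : borel_space R k) : `]t - d / 2, t + d / 2[%classic s -> Om y ->
    `|partial1of2 energy_density s y| <= cst (2 * M) y.
  move=> Is Oy; have [_ dE] := dere s y Is Oy.
  rewrite partial1of2E dE normrM ger0_norm//= ler_pM2l//.
  by apply: (pM (s, y)); split; [exact: IA|exact: subset_closure].
have d1 s (y : borel_space R k) : `]t - d / 2, t + d / 2[%classic s -> Om y ->
    derivable (energy_density ^~ y) s 1.
  by move=> Is Oy; case: (dere s y Is Oy).
apply: DeriveDef.
  exact: (derivable_under_integral mOm It inte d1 G0 intG).
rewrite -derive1E (differentiation_under_integral mOm It inte d1 G0 intG Gub).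
rewrite -RintegralZl//; last exact: power_integrable.
apply: eq_Rintegral => x; rewrite inE => Ox.
by have [_ dE] := dere t x It Ox; rewrite partial1of2E dE.
Qed.

End EnergyRate.

(** * Energy balance *)

Section Balance.
Context (R : realType) (k n mp md : nat).
Context (vol : {measure set (borel_space R k) -> \bar R}) (Om : domain R k).
Context (pb : dual_problem R k n mp md).
Hypothesis leb : is_lebesgue vol.
Hypothesis gauss : gauss_domain vol Om.
Hypothesis adm : admissible Om pb.
Context (Phi : field R k n) (tau : R).
Hypothesis smoothPhi : smooth_field Om Phi.
Hypothesis tau0 : 0 <= tau.

Let K : set 'rV[R]_k := closure Om.
Let V := coefficient_field (ver pb) Phi.
Let Ai i x := matA pb i (V tau x).

Lemma smooth_slice (f : field R k n) :
  smooth_field Om f -> smooth_on K (f tau).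
Proof.
move=> [U [oU KU] Cf]; exists [set x | U (tau, x)].
  by split=> [|x Kx]; [exact: open_slice|exact: KU].
exact: (C1_on_slice Cf).
Qed.

(** The two versions of the problem differ in this lemma only. *)
Lemma coefficient_smooth : smooth_field Om V.
Proof.
rewrite /V /coefficient_field; move: (V_smooth adm).
by case: (ver pb) => [W /(_ W erefl)|].
Qed.

Lemma common_neighbourhood : exists2 W : set 'rV[R]_k, open W /\ K `<=` W &
  C1_on W (Phi tau) /\ forall i, C1_on W (Ai i).
Proof.
have [U [oU KU] CU] := smooth_slice smoothPhi.
have [W [oW KW] CW] := smooth_slice coefficient_smooth.
exists (U `&` W); first by split; [exact: openI|move=> x Kx; split; auto].
split=> [x [Ux _]|i]; first exact: CU.
have [T [_ TT] CA] := A_smooth adm i.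
apply: (C1_on_comp (openI oU oW)) => [x _|x [_ Wx]]; last exact: CW.
by apply: CA; exact: TT.
Qed.

Definition flux (x : 'rV[R]_k) : 'rV[R]_k :=
  \row_i ((Phi tau x)^T *m (Ai i x *m Phi tau x)) ord0 ord0.

Lemma flux_coord i :
  (fun y => flux y ord0 i) =
  (fun y => ((Phi tau y)^T *m (Ai i y *m Phi tau y)) ord0 ord0).
Proof. by apply/funext => y; rewrite mxE. Qed.

Lemma flux_smooth : smooth_on K flux.
Proof.
have [W [oW KW] [CP CA]] := common_neighbourhood.
exists W; [by []|apply: (C1_on_mx oW) => i j].
rewrite ord1 flux_coord.
exact: (C1_on_coord oW ord0 ord0 (C1_on_mulmx oW (C1_on_trmx oW CP)
  (C1_on_mulmx oW (CA j) CP))).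
Qed.

(** The product rule, with [Phi^T] and [A_i Phi] as the two factors: the second
term [(A_i Phi)^T Phi_{x_i}] is the one with the transpose of [A_i] in the dual
equation. *)
Lemma divergence_flux x : K x -> divergence flux x =
  \sum_(i < k) (((Phi tau x)^T *m partial_x i (fun y => Ai i y *m Phi tau y) x)
     ord0 ord0
   + ((Phi tau x)^T *m ((Ai i x)^T *m partial_x i (Phi tau) x)) ord0 ord0).
Proof.
move=> Kx; have [W [oW KW] [CP CA]] := common_neighbourhood.
apply: eq_bigr => i _; rewrite /partial_x flux_coord.
have [/diff_derivable dP _] := CP x (KW x Kx).
have [/diff_derivable dAP _] := C1_on_mulmx oW (CA i) CP (KW x Kx).
have [_ ->] := is_derive_dot (dP (delta_mx ord0 i)) (dAP (delta_mx ord0 i)).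
by rewrite mxE trmx_mul mulmxA.
Qed.

Lemma divergence_flux_continuous : {within K, continuous (divergence flux)}.
Proof.
have [W [oW KW] CF] := flux_smooth.
apply/subspace_continuousP => x Kx; apply: cvg_sum => i.
apply: cvg_within_filter.
by have [_] := C1_on_coord oW ord0 i CF (KW x Kx); exact.
Qed.

Lemma boundary_flux_divergence :
  boundary_flux Om pb Phi tau = \int[vol]_(x in Om) divergence flux x.
Proof.
rewrite (divergence_theorem gauss flux_smooth); apply: eq_Rintegral => x _.
rewrite /normal_matrix mulmx_sumr mulmx_suml summxE.
by apply: eq_bigr => i _; rewrite -scalemxAr -scalemxAl mxE [in RHS]mxE mulmxA.
Qed.

(** The equation multiplied by [Phi^T]: the first-order terms add up to the
divergence of the flux, and the zeroth-order term vanishes. *)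
Lemma power_balance (G : field R k n) x :
  (forall v, matC pb v + (matC pb v)^T = 0) -> dual_equation Om pb G Phi ->
  (Om : set _) x ->
  ((Phi tau x)^T *m matP pb x *m 'D_1 (fun s : R => Phi s x) tau) ord0 ord0
  = divergence flux x + ((Phi tau x)^T *m G tau x) ord0 ord0.
Proof.
move=> skewC eqn Ox; rewrite divergence_flux; last exact: subset_closure.
have /eqP := eqn tau x tau0 Ox; rewrite !subr_eq -/V => /eqP aE.
have addE (M N : 'M[R]_1) :
    (M + N) ord0 ord0 = M ord0 ord0 + N ord0 ord0 by rewrite mxE.
rewrite -mulmxA aE !mulmxDr !mulmx_sumr !addE !summxE.
have := quadratic_skew (Phi tau x) (skewC (V tau x)); rewrite -mulmxA => ->.
by rewrite big_split/=; lra.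
Qed.

(** The forcing [G] has no regularity of its own.  The work that it does is
integrable because [power_balance] expresses it as a difference of two functions
that are continuous on the closed domain. *)
Lemma energy_balance (G : field R k n) :
  (forall v, matC pb v + (matC pb v)^T = 0) -> dual_equation Om pb G Phi ->
  is_derive tau 1 (energy vol Om pb Phi)
    (2 * boundary_flux Om pb Phi tau + 2 * forcing_power vol Om G Phi tau).
Proof.
move=> skewC eqn.
have oO := region_open gauss; have bO := region_bounded gauss.
have [U [oU KU] CU] := smoothPhi.
have UK x : K x -> U (tau, x) by move=> Kx; exact: KU.
have cP := P_continuous adm.
apply: is_derive_eq.
  exact: (energy_is_derive oO bO cP (P_symmetric adm) oU CU leb UK).
rewrite -mulrDr; congr (_ * _).
have intp := power_integrable oO bO cP CU leb UK.
have intd : vol.-integrable Om (EFin \o divergence flux).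
  by apply: continuous_integrable => //; exact: divergence_flux_continuous.
rewrite boundary_flux_divergence /forcing_power.
rewrite [X in _ + X](_ : _ = \int[vol]_(x in Om)
  (((Phi tau x)^T *m matP pb x *m
      'D_(1, 0) (fun tx => Phi tx.1 tx.2) (tau, x)) ord0 ord0
   - divergence flux x)).
  by rewrite RintegralB//; [rewrite addrC subrK|exact: open_borel].
apply: eq_Rintegral => x; rewrite inE => Ox.
rewrite -(derive_time (fun tx => Phi tx.1 tx.2)) (power_balance skewC eqn)//.
by rewrite addrC addKr.
Qed.

End Balance.

Unset Implicit Arguments.

Theorem proposition5p2 (R : realType) (k n mp md : nat)
    (vol : {measure set (borel_space R k) -> \bar R}) (Om : domain R k)
    (pb : dual_problem R k n mp md)
    (G : field R k n) (q : field R k md) (r : 'rV[R]_k -> 'cV[R]_n)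
    (vol_lebesgue : is_lebesgue vol) (Om_gauss : gauss_domain vol Om)
    (pb_admissible : admissible Om pb) :
  ((forall v : 'cV[R]_n, matC pb v + (matC pb v)^T = 0) ->
     energy_conserving vol Om pb G q r)
  /\
  ((forall Phi : field R k n, smooth_field Om Phi ->
      forall tau : R, 0 <= tau ->
      boundary_flux Om pb Phi tau = symmetric_boundary_flux Om pb Phi tau)
   /\
   (energy_conserving vol Om pb (fun _ _ => 0) (fun _ _ => 0) r ->
    dissipative_boundary_conditions Om pb ->
    energy_bounded vol Om pb (fun _ _ => 0) (fun _ _ => 0) r)).
Proof.
have flux_sym Phi tau :
    boundary_flux Om pb Phi tau = symmetric_boundary_flux Om pb Phi tau.
  by apply: eq_Rintegral => x _; rewrite quadratic_symmetrize.
split=> [skewC Phi [smoothPhi eqn _ _] tau tau0|].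
  exact: energy_balance.
split=> [Phi _ tau _|conserving dissipative Phi sol]; first exact: flux_sym.
have [smoothPhi _ bc _] := sol.
have dE (t : R) : 0 <= t -> is_derive t 1 (energy vol Om pb Phi)
    (2 * boundary_flux Om pb Phi t).
  move=> t0; apply: is_derive_eq; first exact: conserving.
  rewrite (_ : forcing_power _ _ _ _ _ = 0) ?mulr0 ?addr0//.
  rewrite /forcing_power; under eq_Rintegral do rewrite mulmx0 mxE.
  by rewrite Rintegral_cst ?mul0r//; exact: open_borel (region_open Om_gauss).
exists (energy vol Om pb Phi 0) => tau tau0.
apply: (@ler0_derive1_nincry _ _ 0) => // [t|t|].
- by rewrite in_itv/= andbT => /ltW /dE[].
- rewrite in_itv/= andbT => /ltW t0; rewrite derive1E.
  have [_ ->] := dE t t0.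
  by rewrite flux_sym pmulr_rle0//; exact: dissipative.
- apply: derivable_within_continuous => t; rewrite in_itv/= andbT => t0.
  by case: (dE t t0).
Qed.
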